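(* Let $v\in\mathbb{N}\setminus\{1\}$ and let $h\colon\mathbb{N}_2\to\mathbb{C}$ be a $v$-transitive convex light weight such that $v\in V(h)$. Suppose that $C_{h,v}(1)_1$, $C_h(1)_1$, $B_{h,v}(1)_1$ and $B_h(1)_1$ exist. Then $B_h(1)_1\ne0$ and $$\lim_{n\to\infty}a_n^{h,v}\in\mathrm{sqrt}\Big(1-\frac{B_{h,v}(1)_1}{B_h(1)_1}\Big).$$
   Context: $\mathbb{N}=\{1,2,\dots\}$, $\mathbb{N}_0=\{0,1,2,\dots\}$, and $\mathbb{N}_2=\{e\subset\mathbb{N}:|e|=2\}$. A weight is a map $h\colon\mathbb{N}_2\to\mathbb{C}$. A walk of length $n\in\mathbb{N}_0$ is a tuple $w=\langle v_0,\dots,v_n\rangle$ of elements of $\mathbb{N}$ with $v_{i-1}\ne v_i$ for $i=1,\dots,n$; its weight is $h(w)=\prod_{i=1}^n h(\{v_{i-1},v_i\})$ (and $h(w)=1$ if $n=0$). A series $\sum_{x\in X}g(x)$ over an at most countable set $X$ converges absolutely if the sums $\sum_{x\in Y}|g(x)|$ over finite $Y\subset X$ are bounded. For a set $W$ of walks, $h(W)$ denotes the sum of $\sum_{w\in W}h(w)$ when it converges absolutely. $W(n)$ is the set of walks of length $n$ with $v_0=1$. The weight $h$ is light if $\sum_{w\in W(n)}h(w)$ converges absolutely for every $n\in\mathbb{N}_0$. $V(h)$ is the set of vertices $u\in\mathbb{N}$ such that some walk starting at $1$ and ending at $u$ has nonzero weight. A light weight $h$ is convex if for every $u\in V(h)$,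 $\sum_{w\in\mathbb{N}\setminus\{u\}}h(\{u,w\})=1$. For $v\in\mathbb{N}\setminus\{1\}$, $h$ is $v$-transitive if there is a bijection $f\colon\mathbb{N}\to\mathbb{N}$ with $f(1)=v$ and $h(\{f(a),f(b)\})=h(\{a,b\})$ for all $\{a,b\}\in\mathbb{N}_2$. Let $a_n^{h,v}=h(W(v,n))$, where $W(v,n)$ is the set of walks in $W(n)$ visiting $v$. Define in $\mathbb{C}[[x]]$ (coefficient of $x^n$ given): $B_h$: weight of walks of length $n$ with $v_0=v_n=1$; $B_{h,v}$: weight of walks of length $n$ with $v_0=v_n=1$ and $v_i\ne v$ for all $i$; $C_h$: weight of walks of length $n\ge1$ with $v_0=v_n=1$ and $v_i\ne1$ for $0<i<n$ (coefficient $0$ for $n=0$); $C_{h,v}$: weight of walks of length $n$ with $v_0=1$, $v_n=v$, $v_i\ne v$ for $i<n$. For $U(x)=\sum_{n\ge0}u_nx^n\in\mathbb{C}[[x]]$, we say $U(1)_1$ exists if $\lim_{n\to\infty}\sum_{j=0}^nu_j$ exists in $\mathbb{C}$, and $U(1)_1$ denotes this limit. For $z\in\mathbb{C}$, $\mathrm{sqrt}(z)=\{\alpha\in\mathbb{C}:\alpha^2=z\}$. *)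

(* Defs.v *)
From mathcomp Require Import all_boot all_order all_algebra finmap.
From mathcomp Require Import complex.
From mathcomp Require Import all_classical all_reals all_analysis.
From mathcomp.analysis.showcase Require summability.

Set Implicit Arguments.
Unset Strict Implicit.
Unset Printing Implicit Defensive.

Import Order.TTheory GRing.Theory Num.Theory.
Import numFieldNormedType.Exports.

Local Open Scope classical_set_scope.
Local Open Scope ring_scope.
Local Open Scope complex_scope.

(* The complex numbers are R[i] with R : realType.  The alias R[i]^o is only
   used to give R[i] the topology of its norm. *)

Section AbsoluteSums.
Variables (R : realType) (T : choiceType).
Implicit Types (X : set T) (g : T -> R[i]).

Definition abs_summable X g : Prop :=
  exists M : R, forall Y : {fset T},
    [set` Y] `<=` X -> \sum_(x <- Y) `|g x| <= M%:C.

(* Limit of the finite partial sums along the directed set of finite subsets;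
   g is replaced by 0 outside X.  Meaningful when abs_summable X g. *)
Definition abs_sum X g : R[i] :=
  summability.sum (patch (fun=> 0) X g : T -> R[i]^o).

End AbsoluteSums.

(* For the formal power series U with coefficient sequence u: convergence of its
   series at 1, and the sum. *)
Section ValueAtOne.
Variable R : realType.
Implicit Types u : nat -> R[i].

Definition has_value1 u : Prop :=
  cvgn (fun n => \sum_(j < n.+1) u j : R[i]^o).

Definition value1 u : R[i] :=
  limn (fun n => \sum_(j < n.+1) u j : R[i]^o).

Definition csqrt (z : R[i]) : set R[i] := [set a | a ^+ 2 = z].

End ValueAtOne.

Definition vertex : Type := {n : nat | (0 < n)%N}.

Definition vertex1 : vertex := exist _ 1%N isT.

Definition edge : Type := {e : {fset vertex} | #|` e|%fset == 2%N}.

(* A walk <v_0, ..., v_n> is the sequence of its n.+1 vertices. *)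
Definition vtx (w : seq vertex) (i : nat) : vertex := nth vertex1 w i.

Definition walk (n : nat) : set (seq vertex) :=
  [set w | size w = n.+1 /\ forall i, (i < n)%N -> vtx w i != vtx w i.+1].

Section Walks.
Variable R : realType.
Implicit Types (h : edge -> R[i]) (v : vertex).

(* h({a,b}); the value 0 given to a = b, where {a,b} is not an edge, is never
   used. *)
Definition ew h (a b : vertex) : R[i] :=
  oapp h 0 (insub [fset a; b]%fset).

Definition walk_weight h (w : seq vertex) : R[i] :=
  \prod_(i < (size w).-1) ew h (vtx w i) (vtx w i.+1).

Definition weight_of h (W : set (seq vertex)) : R[i] :=
  abs_sum W (walk_weight h).

Definition walks_from1 (n : nat) : set (seq vertex) :=
  [set w | walk n w /\ vtx w 0 = vertex1].

Definition light h : Prop :=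
  forall n, abs_summable (walks_from1 n) (walk_weight h).

Definition reachable h : set vertex :=
  [set u | exists n w, [/\ walks_from1 n w, vtx w n = u
                         & walk_weight h w != 0]].

(* Only used for light h, in which case the summability is automatic. *)
Definition convex_weight h : Prop :=
  forall u, reachable h u ->
    abs_summable [set w | w <> u] (ew h u) /\
    abs_sum [set w | w <> u] (ew h u) = 1.

Definition transitive_weight h v : Prop :=
  exists f : vertex -> vertex,
    [/\ bijective f, f vertex1 = v
      & forall a b, a != b -> ew h (f a) (f b) = ew h a b].

Definition visit_weight h v (n : nat) : R[i] :=
  weight_of h [set w | walks_from1 n w /\ v \in w].

Definition B_series h (n : nat) : R[i] :=
  weight_of h [set w | walks_from1 n w /\ vtx w n = vertex1].

Definition Bv_series h v (n : nat) : R[i] :=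
  weight_of h [set w | [/\ walks_from1 n w, vtx w n = vertex1
                         & forall i, (i <= n)%N -> vtx w i != v]].

(* The coefficient at n = 0 is the empty sum. *)
Definition C_series h (n : nat) : R[i] :=
  weight_of h [set w | [/\ (1 <= n)%N, walks_from1 n w, vtx w n = vertex1
                         & forall i, (0 < i < n)%N -> vtx w i != vertex1]].

Definition Cv_series h v (n : nat) : R[i] :=
  weight_of h [set w | [/\ walks_from1 n w, vtx w n = v
                         & forall i, (i < n)%N -> vtx w i != v]].

End Walks.

(* Main.v *)
Require Import Defs.
From mathcomp Require Import all_boot all_order all_algebra finmap.
From mathcomp Require Import complex.
From mathcomp Require Import all_classical all_reals all_analysis.
From mathcomp.analysis.showcase Require summability.

(** Write B, B_v, C, C_v for the generating functions. By convexity the total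
    weight of a set of walks from 1 is unchanged when every walk is extended by
    one step, so a_n is the n-th partial sum of C_v and the limit is C_v(1).
    Cutting a closed walk at its first return to 1 gives B = 1 + C B. Cutting it
    at its first visit to v, the remainder is a walk from v to 1, that is a
    reversed walk from 1 to v, which is cut again at its first visit to v; as
    closed walks at v have generating function B by transitivity, this gives
    B = B_v + C_v (C_v B). Hence B (1 - C) = 1 and C_v C_v = 1 - B_v (1 - C).
    Both are identities between products of two series that converge at 1, so
    Cesaro summation of Cauchy products lets one substitute x = 1. *)

Set Implicit Arguments.
Unset Strict Implicit.
Unset Printing Implicit Defensive.

Import Order.TTheory GRing.Theory Num.Theory.
Import numFieldNormedType.Exports.

Local Open Scope classical_set_scope.
Local Open Scope ring_scope.
Local Open Scope complex_scope.

(** * Unconditional sums *)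

Section HasSum.
Variable K : numFieldType.
Implicit Types T I : choiceType.

(** Convergence of the net of finite partial sums, written with epsilons; the condition [0 < e]
    already forces [e] to be real. *)
Definition has_sum T (f : T -> K) (s : K) : Prop :=
  forall e : K, 0 < e -> exists A : {fset T}, forall B : {fset T},
    (A `<=` B)%fset -> `|\sum_(x <- B) f x - s| < e.

Lemma eq_has_sum T (f g : T -> K) s : f =1 g -> has_sum f s -> has_sum g s.
Proof.
by move=> fg fs e /fs[A HA]; exists A => B /HA; rewrite (eq_bigr g).
Qed.

Lemma has_sum_unique T (f : T -> K) s t : has_sum f s -> has_sum f t -> s = t.
Proof.
move=> fs ft; apply/eqP; rewrite -subr_eq0 -normr_eq0; apply/negPn/negP => st.
have e0 : 0 < `|s - t| / 2 by rewrite divr_gt0 // lt_def st normr_ge0.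
have [A HA] := fs _ e0; have [B HB] := ft _ e0.
have := ltrD (HA _ (fsubsetUl A B)) (HB _ (fsubsetUr A B)).
rewrite -splitr distrC => /(le_lt_trans (ler_normD _ _)).
by rewrite addrA subrK ltxx.
Qed.

Lemma has_sumD T (f g : T -> K) s t :
  has_sum f s -> has_sum g t -> has_sum (fun x => f x + g x) (s + t).
Proof.
move=> fs gt e e0; have e2 : 0 < e / 2 by rewrite divr_gt0.
have [A HA] := fs _ e2; have [B HB] := gt _ e2.
exists (A `|` B)%fset => D; rewrite fsubUset => /andP[/HA AD /HB BD].
rewrite big_split opprD addrACA (le_lt_trans (ler_normD _ _)) //.
by rewrite [ltRHS]splitr ltrD.
Qed.

Lemma has_sumZ T (f : T -> K) s a :
  has_sum f s -> has_sum (fun x => a * f x) (a * s).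
Proof.
move=> fs e e0; have [->|a0] := eqVneq a 0.
  exists fset0 => B _; rewrite big1 ?mul0r ?subrr ?normr0 // => x _.
  by rewrite mul0r.
have /fs[A HA] : 0 < e / `|a| by rewrite divr_gt0 // normr_gt0.
exists A => B /HA; rewrite -mulr_sumr -mulrBr normrM.
by rewrite ltr_pdivlMr ?normr_gt0 // mulrC.
Qed.

Lemma has_sum_fin T (f : T -> K) (A : {fset T}) :
  (forall x, x \notin A -> f x = 0) -> has_sum f (\sum_(x <- A) f x).
Proof.
move=> fA e e0; exists A => B AB.
by rewrite (big_fset_incl _ AB) ?subrr ?normr0 // => x _ /fA.
Qed.

Lemma has_sum0 T (f : T -> K) : (forall x, f x = 0) -> has_sum f 0.
Proof.
by move=> f0; rewrite -(big_seq_fset0 +%R f); apply: has_sum_fin => x _.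
Qed.

Lemma has_sum1 T (f : T -> K) a : (forall x, x != a -> f x = 0) ->
  has_sum f (f a).
Proof.
move=> f0; rewrite -(big_seq_fset1 +%R a f); apply: has_sum_fin => x.
by rewrite in_fset1 => /f0.
Qed.

Lemma has_sum_sum T (n : nat) (F : nat -> T -> K) (s : nat -> K) :
  (forall k, (k < n)%N -> has_sum (F k) (s k)) ->
  has_sum (fun x => \sum_(k < n) F k x) (\sum_(k < n) s k).
Proof.
elim: n => [|n IHn] Fs.
  by rewrite big_ord0; apply: has_sum0 => x; rewrite big_ord0.
rewrite big_ord_recr /=; under [X in has_sum X _]eq_fun do rewrite big_ord_recr.
apply: has_sumD; last exact: Fs.
by apply: IHn => k /ltnW; exact: Fs.
Qed.

(** Summation in blocks. For a finite set [P] of indices containing the image of [A], one finite set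
    is found that is accurate on every fibre over [P] and still contains [A]. *)
Lemma has_sum_fibers T I (f : T -> K) (p : T -> I) (G : I -> K) s :
  has_sum f s -> (forall i, has_sum (fun x => f x *+ (p x == i)) (G i)) ->
  has_sum G s.
Proof.
move=> fs fG e e0; have e2 : 0 < e / 2 by rewrite divr_gt0.
have [A HA] := fs _ e2.
exists [fset p x | x in A]%fset => P AP.
(* [#|P|] errors below [d] add up to strictly less than [e / 2]; the successor also covers an empty
   [P]. *)
pose d : K := e / 2 / (#|` P|.+1)%:R.
have d0 : 0 < d by rewrite divr_gt0 ?ltr0n.
have /choice[D HD] i : exists D : {fset T}, forall B : {fset T},
    (D `<=` B)%fset -> `|\sum_(x <- B) f x *+ (p x == i) - G i| < d.
  exact: fG.
pose F := (A `|` \bigcup_(i <- P) D i)%fset.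
(* Keeping only the fibres over [P] loses no point of [A], so the sum over [F'] stays within [e / 2]
   of [s]. *)
pose F' := [fset x in F | p x \in P]%fset.
have AF' : (A `<=` F')%fset.
  apply/fsubsetP => x xA; rewrite !inE /= xA /=.
  by apply: (fsubsetP AP); apply/imfsetP; exists x.
have FF' : \sum_(x <- F') f x = \sum_(i <- P) \sum_(x <- F) f x *+ (p x == i).
  rewrite exchange_big /= big_fset /= big_mkcond /=; apply: eq_bigr => x _.
  case: ifPn => [pxP|pxP].
    rewrite (big_fsetD1 (p x)) //= eqxx mulr1n big_seq big1 ?addr0 // => i.
    by rewrite in_fsetD1 eq_sym => /andP[/negbTE->].
  rewrite big_seq big1 // => i iP; case: eqP => // pxi.
  by rewrite pxi iP in pxP.
have GF : `|\sum_(i <- P) G i - \sum_(x <- F') f x| < e / 2.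
  rewrite FF' -sumrB (le_lt_trans (ler_norm_sum _ _ _)) //.
  apply: (@le_lt_trans _ _ (\sum_(i <- P) d)).
    rewrite big_seq [leRHS]big_seq; apply: ler_sum => i iP.
    rewrite distrC ltW // HD // /F fsubsetU //; apply/orP; right.
    exact: bigfcup_sup.
  rewrite big_const_seq count_predT iter_addr_0 -[ltLHS]mulr_natr.
  by rewrite /d -mulrA gtr_pMr // mulrC ltr_pdivrMr ?ltr0n // mul1r ltr_nat.
rewrite -(subrK (\sum_(x <- F') f x) (\sum_(i <- P) G i)) -addrA.
rewrite (le_lt_trans (ler_normD _ _)) // [ltRHS]splitr ltrD //.
exact: HA.
Qed.

(** Extension by zero outside [X], to match the form of [abs_sum]. *)
Definition sums_on T (X : set T) (g : T -> K) (s : K) : Prop :=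
  has_sum (patch (fun=> 0) X g) s.

Lemma sums_on_unique T (X : set T) (g : T -> K) s t :
  sums_on X g s -> sums_on X g t -> s = t.
Proof. exact: has_sum_unique. Qed.

Lemma eq_sums_on T (X : set T) (f g : T -> K) s :
  {in X, f =1 g} -> sums_on X f s -> sums_on X g s.
Proof.
move=> fg; apply: eq_has_sum => x; rewrite /patch; case: ifP => // xX.
exact: fg.
Qed.

Lemma sums_onZ T (X : set T) (g : T -> K) s a :
  sums_on X g s -> sums_on X (fun x => a * g x) (a * s).
Proof.
move=> /(@has_sumZ _ _ _ a); apply: eq_has_sum => x; rewrite /patch.
by case: ifP; rewrite ?mulr0.
Qed.

Lemma sums_on0 T (X : set T) (g : T -> K) : {in X, forall x, g x = 0} ->
  sums_on X g 0.
Proof.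
by move=> g0; apply: has_sum0 => x; rewrite /patch; case: ifP => [/g0|].
Qed.

Lemma sums_on_set1 T (a : T) (g : T -> K) : sums_on [set a] g (g a).
Proof.
have <- : patch (fun=> 0) [set a] g a = g a by rewrite patchE mem_set.
by apply: has_sum1 => x xa; rewrite patchE memNset // => /eqP; apply/negP.
Qed.

Lemma sums_on_fibers T I (X : set T) (Y : set I) (g : T -> K) (p : T -> I)
    (G : I -> K) s : (forall x, X x -> Y (p x)) ->
  sums_on X g s ->
  (forall i, Y i -> sums_on [set x | X x /\ p x = i] g (G i)) ->
  sums_on Y G s.
Proof.
move=> XY Xg YG; apply: (@has_sum_fibers _ _ _ p _ _ Xg) => i.
rewrite [X in has_sum _ X]/patch.
have [/set_mem Yi|/negP Yi] := boolP (i \in Y).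
  apply: eq_has_sum (YG i Yi) => x; rewrite /patch.
  have [/set_mem Xx|/negP Xx] := boolP (x \in X); last first.
    by rewrite mul0rn memNset // => -[/mem_set/Xx].
  case: eqP => pxi; first by rewrite mem_set.
  by rewrite memNset // => -[].
apply: has_sum0 => x; rewrite /patch.
case: ifPn => [/set_mem Xx|_]; last by rewrite mul0rn.
by case: eqP => // pxi; case: Yi; rewrite -pxi; apply/mem_set/XY.
Qed.

(** By injectivity every fibre of [f] over the image is a single point. *)
Lemma sums_on_image T I (X : set T) (f : T -> I) (g : T -> K) (k : I -> K) s :
  set_inj X f -> {in X, forall x, k (f x) = g x} ->
  sums_on X g s -> sums_on (f @` X) k s.
Proof.
move=> finj kg Xg; apply: (@sums_on_fibers _ _ _ _ _ f _ _ _ Xg).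
  by move=> x Xx; exists x.
move=> _ [x Xx <-]; rewrite (_ : [set _ | _] = [set x]); last first.
  by apply/seteqP; split => [y [Xy /finj]|_ ->//]; apply; exact: mem_set.
by rewrite kg ?mem_set //; exact: sums_on_set1.
Qed.

Lemma sums_on_bigcup T (X : set T) (Y : nat -> set T) (g : T -> K) n s :
  (forall k x, (k < n)%N -> Y k x -> X x) ->
  (forall x, X x -> exists2 k, (k < n)%N & Y k x) ->
  (forall x j k, (j < n)%N -> (k < n)%N -> Y j x -> Y k x -> j = k) ->
  (forall k, (k < n)%N -> sums_on (Y k) g (s k)) ->
  sums_on X g (\sum_(k < n) s k).
Proof.
move=> YX XY Yinj Ys; apply: eq_has_sum (has_sum_sum Ys) => x.
rewrite [RHS]/patch; case: ifPn => [/set_mem/XY[k kn Ykx]|/negP Xx].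
  rewrite (bigD1 (Ordinal kn)) //= patchE mem_set // big1 ?addr0 // => j jk.
  rewrite patchE memNset // => Yjx; case/eqP: jk.
  by apply/val_inj/(Yinj x j k) => //=.
rewrite big1 // => k _; rewrite patchE memNset // => Ykx; apply: Xx.
by apply/mem_set/(YX k).
Qed.

Lemma sums_onU T (X Y Z : set T) (g : T -> K) s t :
  (forall x, Z x <-> X x \/ Y x) -> (forall x, X x -> ~ Y x) ->
  sums_on X g s -> sums_on Y g t -> sums_on Z g (s + t).
Proof.
move=> ZXY XY Xs Yt; apply: eq_has_sum (has_sumD Xs Yt) => x.
have [Xx|Xx] := pselect (X x).
  rewrite !patchE (mem_set Xx) (memNset (XY x Xx)) addr0 mem_set //.
  by apply/ZXY; left.
rewrite [X in X + _]patchE (memNset Xx) add0r !patchE.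
have [Yx|Yx] := pselect (Y x).
  by rewrite !mem_set //; apply/ZXY; right.
by rewrite !memNset // => /ZXY[].
Qed.

End HasSum.

(** * Absolute convergence of complex families *)

Section Complex.
Variable R : realType.

Lemma normc_real (x : R) : `|x%:C| = `|x|%:C.
Proof. by rewrite normc_def /= expr0n addr0 sqrtr_sqr. Qed.

(** The finite sums grow with the set, so their supremum is the sum. *)
Lemma has_sum_nonneg (T : choiceType) (f : T -> R) M : (forall x, 0 <= f x) ->
  (forall A : {fset T}, \sum_(x <- A) f x <= M) ->
  exists s, has_sum (fun x => (f x)%:C) s%:C.
Proof.
move=> f0 fM; pose E := [set \sum_(x <- A) f x | A in [set: {fset T}]].
have supE : has_sup E.
  split; first by exists (\sum_(x <- fset0) f x); exists fset0.
  by exists M => _ [A _ <-].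
exists (sup E) => e e0.
have eE : e = (complex.Re e)%:C by rewrite RRe_real // gtr0_real.
have e0' : 0 < complex.Re e by rewrite -ltcR -eE.
have [_ [A _ <-] ltA] := sup_adherent e0' supE; exists A => B AB.
have leAB : \sum_(x <- A) f x <= \sum_(x <- B) f x.
  rewrite (big_fsetID _ (mem A) B) /= (_ : [fset x in B | x \in A]%fset = A).
    by rewrite lerDl sumr_ge0.
  apply/fsetP => x; rewrite !inE /=; apply/andP/idP => [[]//|xA]; split=> //.
  exact: (fsubsetP AB).
have leB : \sum_(x <- B) f x <= sup E.
  by apply: sup_upper_bound => //; exists B.
rewrite (_ : _ - _ = (\sum_(x <- B) f x - sup E)%:C).
  2: by rewrite rmorphB rmorph_sum.
rewrite normc_real distrC eE ltcR.
rewrite ger0_norm ?subr_ge0 // ltrBlDr -ltrBlDl.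
exact: lt_le_trans ltA leAB.
Qed.

(** [f] is the difference of [f + |f|] and [|f|], two nonnegative families with bounded finite
    sums. *)
Lemma has_sum_real (T : choiceType) (f : T -> R) M :
  (forall A : {fset T}, \sum_(x <- A) `|f x| <= M) ->
  exists s, has_sum (fun x => (f x)%:C) s.
Proof.
move=> fM.
have [s sf] := has_sum_nonneg (fun x => normr_ge0 (f x)) fM.
have [] := @has_sum_nonneg T (fun x => f x + `|f x|) (M + M).
- by move=> x; rewrite -lerBlDl sub0r -normrN ler_norm.
- by move=> A; rewrite big_split lerD ?(le_trans _ (fM A)) ?ler_sum // => x _;
    rewrite ler_norm.
move=> t tf; exists (t%:C + (-1) * s%:C).
apply: eq_has_sum (has_sumD tf (has_sumZ (-1) sf)) => x.
by rewrite mulN1r -rmorphB /= addrK.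
Qed.

(** The real and imaginary parts are both dominated by the modulus. *)
Lemma has_sum_abs (T : choiceType) (f : T -> R[i]) M :
  (forall A : {fset T}, \sum_(x <- A) `|f x| <= M%:C) -> exists s, has_sum f s.
Proof.
move=> fM.
have part (g : T -> R) : (forall x, `|g x|%:C <= `|f x|) ->
    exists s, has_sum (fun x => (g x)%:C) s.
  move=> gf; apply: (@has_sum_real _ g M) => A.
  rewrite -lecR rmorph_sum /= (le_trans _ (fM A)) //.
  by apply: ler_sum => x _.
have [s sf] := part (fun x => complex.Re (f x)) (fun x => normc_ge_Re _).
have [|t tf] := part (fun x => complex.Im (f x)).
  (* Up to sign, the imaginary part is the real part after multiplication by ['i], which has modulus
     1. *)
  move=> x; have := normc_ge_Re (f x * 'i); rewrite ReiNIm normrN normrM.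
  by rewrite (normc_def 'i) /= expr0n expr1n add0r sqrtr1 mulr1.
exists (s + 'i * t); apply: eq_has_sum (has_sumD sf (has_sumZ 'i tf)) => x.
by rewrite -complexE.
Qed.

Lemma abs_sumE (T : choiceType) (X : set T) (g : T -> R[i]) s :
  sums_on X g s -> abs_sum X g = s.
Proof.
move=> gs; have totallyF := @summability.totally_filter T.
apply: (@cvg_lim (R[i]^o)); first exact: norm_hausdorff.
apply/cvgrPdist_lt => e /gs[A HA]; exists A => // B /HA.
by rewrite distrC /summability.partial_sum big_seq_fsetE.
Qed.

(** A bound for the finite sums inside [X] also serves for those inside [Y]. Lightness thus gives a
    sum over every subset of [walks_from1 n]. *)
Lemma abs_sumP (T : choiceType) (X Y : set T) (g : T -> R[i]) : Y `<=` X ->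
  abs_summable X g -> sums_on Y g (abs_sum Y g).
Proof.
move=> YX [M HM]; have [|s gs] := @has_sum_abs T (patch (fun=> 0) Y g) M.
  move=> A; rewrite (big_fsetID _ (fun x => x \in Y) A) /= [X in _ + X]big1_seq.
    rewrite addr0 (le_trans _ (HM [fset x in A | x \in Y]%fset _)) //.
    2: by move=> x /=; rewrite !inE => /andP[_ /set_mem/YX].
    rewrite big_seq [leRHS]big_seq; apply: ler_sum => x.
    by rewrite !inE /patch => /andP[_ ->].
  move=> x; rewrite !inE /patch => /andP[_ /andP[_ /negbTE->]].
  by rewrite normr0.
by rewrite (abs_sumE gs).
Qed.

End Complex.

(** * Cauchy products and Cesaro means *)

Section CauchyProduct.
Variable K : comNzRingType.
Implicit Types u w z : nat -> K.

Definition cauchy_prod u w (n : nat) : K := \sum_(j < n.+1) u j * w (n - j)%N.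

Definition unit_series (n : nat) : K := (n == 0%N)%:R.

Definition partial_sums u (n : nat) : K := \sum_(j < n.+1) u j.

Local Notation "u ** w" := (cauchy_prod u w) (at level 40, left associativity).

(** Truncating to polynomials does not change the coefficients up to [n], so the ring laws can be
    taken from polynomials. *)
Lemma cauchy_prod_coef u w n i : (i <= n)%N ->
  (u ** w) i = (\poly_(j < n.+1) u j * \poly_(j < n.+1) w j)`_i.
Proof.
move=> le_in; rewrite coefM; apply: eq_bigr => j _; rewrite !coef_poly !ltnS.
by rewrite !(leq_trans _ le_in) ?leq_subr // -ltnS.
Qed.

Lemma cauchy_prodC u w : u ** w = w ** u.
Proof. by apply/funext => n; rewrite !(@cauchy_prod_coef _ _ n) // mulrC. Qed.

Lemma cauchy_prodA u w z : u ** (w ** z) = u ** w ** z.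
Proof.
apply/funext => n; pose P a := \poly_(j < n.+1) (a j : K).
transitivity ((P u * (P w * P z))`_n).
  rewrite coefM; apply: eq_bigr => j _.
  by rewrite coef_poly ltn_ord (@cauchy_prod_coef _ _ n) ?leq_subr.
rewrite mulrA coefM; apply: eq_bigr => j _.
by rewrite coef_poly ltnS leq_subr (@cauchy_prod_coef _ _ n) // -ltnS.
Qed.

Lemma cauchy_prodBl u w z : (u - w) ** z = u ** z - w ** z.
Proof.
apply/funext => n; rewrite -[RHS]sumrB; apply: eq_bigr => j _.
by rewrite -mulrBl.
Qed.

Lemma cauchy_prodBr u w z : u ** (w - z) = u ** w - u ** z.
Proof. by rewrite cauchy_prodC cauchy_prodBl !(cauchy_prodC u). Qed.

Lemma cauchy_prod1r u : u ** unit_series = u.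
Proof.
apply/funext => n; rewrite /cauchy_prod (bigD1 ord_max) //= subnn mulr1 big1.
  by rewrite addr0.
move=> j jn; rewrite /unit_series subn_eq0 leqNgt (_ : j < n)%N ?mulr0 //.
by rewrite ltn_neqAle -ltnS ltn_ord andbT.
Qed.

Lemma cauchy_prod1l u : unit_series ** u = u.
Proof. by rewrite cauchy_prodC cauchy_prod1r. Qed.

(** The constant sequence 1 is the series 1/(1-x). *)
Lemma partial_sumsE u : partial_sums u = u ** (fun=> 1).
Proof. by apply/funext => n; apply: eq_bigr => j _; rewrite mulr1. Qed.

(** Both sides are the series u w/(1-x)^2. *)
Lemma partial_sums2_cauchy_prod u w :
  partial_sums (partial_sums (u ** w)) = partial_sums u ** partial_sums w.
Proof.
rewrite !partial_sumsE -!cauchy_prodA; congr (_ ** _).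
by rewrite !cauchy_prodA (cauchy_prodC w).
Qed.

(** The first hypothesis says that [unit_series - c] is inverse to [b]; multiplying the second by it
    eliminates [b]. *)
Lemma renewal_equations b c bv cv :
  b = unit_series + c ** b -> b = bv + cv ** (cv ** b) ->
  b ** (unit_series - c) = unit_series /\
  bv ** (unit_series - c) = unit_series - cv ** cv.
Proof.
move=> b1 b2; have bc : b ** (unit_series - c) = unit_series.
  by rewrite cauchy_prodBr cauchy_prod1r (cauchy_prodC b) [X in X - _]b1 addrK.
split=> //; have -> : bv = b - cv ** cv ** b.
  by rewrite -cauchy_prodA [X in X - _]b2 addrK.
by rewrite cauchy_prodBl bc -cauchy_prodA bc cauchy_prod1r.
Qed.

End CauchyProduct.

(** * Limits of complex sequences and Cesaro summation *)

Section Cesaro.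
Variable R : realType.
Implicit Types u w : nat -> R[i].

Local Notation "u ** w" := (cauchy_prod u w) (at level 40, left associativity).

(* Filter convergence in [R[i]^o], spelled out with the norm of [R[i]]:
   unifying the algebraic structures of [R[i]] and [R[i]^o] is very slow. *)
Definition tends u (s : R[i]) : Prop :=
  forall e : R[i], 0 < e -> \forall n \near \oo, `|u n - s| < e.

Lemma tendsP u (s : R[i]) :
  tends u s <-> (u n : R[i]^o) @[n --> \oo] --> (s : R[i]^o).
Proof. by apply: iff_sym; exact: (@cvgrPdistC_lt _ (R[i]^o)). Qed.

Lemma tends_unique u s t : tends u s -> tends u t -> s = t.
Proof.
by move=> /tendsP us /tendsP; apply: cvg_unique us; exact: norm_hausdorff.
Qed.

Lemma tends_cst (s : R[i]) : tends (fun=> s) s.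
Proof. by move=> e e0; apply: nearW => n; rewrite subrr normr0. Qed.

Lemma tendsD u w s t : tends u s -> tends w t ->
  tends (fun n => u n + w n) (s + t).
Proof.
move=> us wt e e0; have e2 : 0 < e / 2 by rewrite divr_gt0.
apply: filterS2 (us _ e2) (wt _ e2) => n un wn.
by rewrite opprD addrACA (le_lt_trans (ler_normD _ _)) // [ltRHS]splitr ltrD.
Qed.

Lemma tendsZ a u s : tends u s -> tends (fun n => a * u n) (a * s).
Proof.
move=> us e e0; have [->|a0] := eqVneq a 0.
  by apply: nearW => n; rewrite !mul0r subrr normr0.
have /us : 0 < e / `|a| by rewrite divr_gt0 // normr_gt0.
apply: filterS => n; rewrite -mulrBr normrM ltr_pdivlMr ?normr_gt0 //.
by rewrite mulrC.
Qed.

Lemma tendsB u w s t : tends u s -> tends w t ->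
  tends (fun n => u n - w n) (s - t).
Proof.
move=> us wt; rewrite -mulN1r (_ : (fun n => _) = fun n => u n + -1 * w n).
  exact: tendsD us (tendsZ (-1) wt).
by apply/funext => n; rewrite mulN1r.
Qed.

Lemma tends_bound u s : tends u s -> exists M : R[i], forall n, `|u n| <= M.
Proof.
move=> /tendsP us; have /cvg_seq_bounded/pinfty_ex_gt0[M M0 uM] :=
  cvgP (s : R[i]^o) us.
by exists M => n; exact: uM.
Qed.

Definition mean u (n : nat) : R[i] := partial_sums u n / n.+1%:R.

(** The moduli are real numbers, so the Cesaro theorem is applied to their real parts and carried
    back to [R[i]]. *)
Lemma tends_mean_norm u : tends u 0 -> tends (mean (fun n => `|u n|)) 0.
Proof.
move=> u0.
have r0 : complex.Re `|u n| @[n --> \oo] --> (0 : R).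
  apply/cvgr0Pnorm_lt => e e0; have e0' : (0 : R[i]) < e%:C by rewrite ltcR.
  apply: filterS (u0 _ e0') => n; rewrite subr0.
  have re0 : 0 <= complex.Re `|u n|.
    by have := normr_ge0 (u n); rewrite lecE => /andP[].
  by rewrite (ger0_norm re0) -ltcR RRe_real ?normr_real.
have /cvgr0Pnorm_lt r0' := cesaro r0.
move=> e e0.
have [r eE] : exists r, e = r%:C by apply/complex_realP/gtr0_real.
move: e0; rewrite eE ltcR => r_gt0; apply: filterS (r0' _ r_gt0) => n.
rewrite -ltcR subr0.
have -> : mean (fun n => `|u n|) n =
    (arithmetic_mean (fun n => complex.Re `|u n|) n)%:C.
  rewrite /mean /arithmetic_mean seriesEord /= rmorphM fmorphV rmorph_nat.
  by rewrite rmorph_sum mulrC.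
by rewrite normc_real.
Qed.

(* The double partial sums of a Cauchy product are the Cauchy product of the
   partial sums; hence, although the product series itself may diverge, it has
   Cesaro sum [s * t]. *)
Lemma mean_cauchy_prod u w s t :
  tends (partial_sums u) s -> tends (partial_sums w) t ->
  tends (mean (partial_sums (u ** w))) (s * t).
Proof.
move=> us wt; have [M wM] := tends_bound wt.
pose S n := partial_sums u n - s; pose T n := partial_sums w n - t.
have S0 : tends S 0 by rewrite -(subrr s); exact: tendsB us (tends_cst s).
have T0 : tends T 0 by rewrite -(subrr t); exact: tendsB wt (tends_cst t).
(* With U and W the partial sums, U_j W_(n-j) - s t = (U_j - s) W_(n-j) + s (W_(n-j) - t). Averaged
   over j, the first term is controlled by the bound [M] on W, and the second is reindexed by
   reversal. *)
have split_mean n : mean (partial_sums (u ** w)) n - s * t =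
    (\sum_(j < n.+1) S j * partial_sums w (n - j)) / n.+1%:R
    + s * (\sum_(j < n.+1) T j) / n.+1%:R.
  have n0 : n.+1%:R != 0 :> R[i] by rewrite pnatr_eq0.
  rewrite /mean partial_sums2_cauchy_prod -mulrDl; apply: (mulIf n0).
  rewrite mulrBl !divfK // mulr_sumr.
  rewrite [X in _ = _ + X](reindex_inj rev_ord_inj) /= -big_split /=.
  rewrite mulr_natr -[X in _ *+ X]card_ord -sumr_const /cauchy_prod -sumrB.
  apply: eq_bigr => j _; rewrite subSS /S /T mulrBl mulrBr.
  by rewrite addrA subrK.
have bound n : `|mean (partial_sums (u ** w)) n - s * t| <=
    M * mean (fun n => `|S n|) n
    + `|s| * mean (fun n => `|T n|) n.
  rewrite split_mean (le_trans (ler_normD _ _)) // lerD //.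
    rewrite normrM normfV (@ger0_norm _ n.+1%:R) // mulrA ler_pM2r ?invr_gt0 //.
    rewrite (le_trans (ler_norm_sum _ _ _)) // mulr_sumr ler_sum // => j _.
    by rewrite normrM mulrC ler_wpM2r.
  rewrite !normrM normfV (@ger0_norm _ n.+1%:R) // -mulrA ler_wpM2l //.
  by rewrite ler_wpM2r ?invr_ge0 // ler_norm_sum.
move=> e e0; have := tendsD (tendsZ M (tends_mean_norm S0))
  (tendsZ `|s| (tends_mean_norm T0)).
rewrite !mulr0 addr0 => /(_ e e0); apply: filterS => n; rewrite subr0.
apply: le_lt_trans; rewrite (le_trans (bound n)) // real_ler_norm //.
exact: ger0_real (le_trans _ (bound n)).
Qed.

(** The products might diverge at 1, but their Cesaro means converge to the products of the values.
    Comparing limits of means gives [B * (1 - C) = 1], so [B] is nonzero with inverse [1 - C]. *)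
Lemma value_renewal b c bv cv (B C BV CV : R[i]) :
  tends (partial_sums b) B -> tends (partial_sums c) C ->
  tends (partial_sums bv) BV -> tends (partial_sums cv) CV ->
  b = unit_series R[i] + c ** b -> b = bv + cv ** (cv ** b) ->
  B != 0 /\ CV ^+ 2 = 1 - BV / B.
Proof.
move=> bB cC bvBV cvCV b1 b2; have [bc bvc] := renewal_equations b1 b2.
have unit1 : partial_sums (unit_series R[i]) = fun=> 1.
  by rewrite partial_sumsE cauchy_prod1l.
have uc : tends (partial_sums (unit_series R[i] - c)) (1 - C).
  rewrite partial_sumsE cauchy_prodBl -!partial_sumsE unit1.
  exact: tendsB (tends_cst 1) cC.
(* The unit series is its own square, so [mean_cauchy_prod] applies to it as well. *)
have mean1 : tends (mean (partial_sums (unit_series R[i]))) 1.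
  rewrite -[1]mulr1 -[unit_series _]cauchy_prod1r.
  by apply: mean_cauchy_prod; rewrite unit1; exact: tends_cst.
have BC : B * (1 - C) = 1.
  by apply: tends_unique mean1; rewrite -bc; exact: mean_cauchy_prod.
have CV2 : CV * CV = 1 - BV * (1 - C).
  (* [cv ** cv] is the unit series minus [bv ** (unit_series - c)], and means are linear. *)
  apply: (tends_unique (mean_cauchy_prod cvCV cvCV)).
  have := tendsB mean1 (mean_cauchy_prod bvBV uc); rewrite bvc.
  congr (tends _ _); apply/funext => n.
  rewrite /mean -mulrBl !partial_sumsE !cauchy_prodBl.
  by congr (_ / _); rewrite -[LHS]/((_ - (_ - _)) n) subKr.
have B0 : B != 0.
  by apply: contra_eq_neq BC => ->; rewrite mul0r eq_sym oner_eq0.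
split=> //; rewrite expr2 CV2; congr (_ - _ * _).
by apply: (mulfI B0); rewrite BC divff.
Qed.

End Cesaro.

(** * Walks *)

Arguments vtx w i : simpl never.

Section Walks.
Variables (R : realType) (h : edge -> R[i]).
Implicit Types (a b c u : vertex) (w : seq vertex).
Local Notation wt := (walk_weight h).

Definition walks_between a n b : set (seq vertex) :=
  [set w | [/\ walk n w, vtx w 0 = a & vtx w n = b]].

(** With [lo = 0] the first visit counts time 0; with [lo = 1] time 0 is ignored, which describes a
    first return. *)
Definition first_passage lo b n : set (seq vertex) :=
  [set w | [/\ (lo <= n)%N, walks_from1 n w, vtx w n = b
             & forall i, (lo <= i < n)%N -> vtx w i != b]].

Lemma ewC a b : ew h a b = ew h b a.
Proof. by rewrite /ew fsetUC. Qed.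

Lemma vtx_take k w i : (i <= k)%N -> vtx (take k.+1 w) i = vtx w i.
Proof. by move=> ik; rewrite /vtx nth_take. Qed.

Lemma vtx_drop k w i : vtx (drop k w) i = vtx w (k + i).
Proof. exact: nth_drop. Qed.

(** Both pieces contain the vertex at time [k], so each step lies in exactly one piece and no
    junction condition arises. *)
Lemma walk_cut k m w : walk (k + m) w <->
  [/\ size w = (k + m).+1, walk k (take k.+1 w) & walk m (drop k w)].
Proof.
split=> [[sw ww]|[sw [_ wk] [_ wm]]]; split=> //.
- split=> [|i ik]; first by rewrite size_takel // sw ltnS leq_addr.
  by rewrite !vtx_take ?(ltnW ik) //; apply/ww/ltn_addr.
- split=> [|i im]; first by rewrite size_drop sw -addnS addKn.
  by rewrite !vtx_drop addnS; apply: ww; rewrite ltn_add2l.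
move=> i ikm; have [ik|ki] := ltnP i k.
  by have := wk i ik; rewrite !vtx_take // ltnW.
have := wm (i - k)%N; rewrite !vtx_drop addnS subnKC //; apply.
by rewrite ltn_subLR.
Qed.

Lemma walk_weight_cut k m w : size w = (k + m).+1 ->
  wt w = wt (take k.+1 w) * wt (drop k w).
Proof.
move=> sw; rewrite /walk_weight size_takel; last by rewrite sw ltnS leq_addr.
rewrite size_drop sw subSn ?leq_addr // addKn /= big_split_ord /=.
congr (_ * _).
  apply: eq_bigr => i _; have ik := ltn_ord i.
  by rewrite !vtx_take ?(ltnW ik).
by apply: eq_bigr => i _; rewrite !vtx_drop addnS.
Qed.

(** The walks are grouped by their first piece [w1]; the group is a copy of the set [B] at the
    endpoint of [w1], with weights scaled by [wt w1]. The inner sum is required only when [wt w1] is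
    nonzero, since convexity speaks only of reachable vertices. *)
Lemma sums_on_cut k m (A : set (seq vertex)) (B : vertex -> set (seq vertex))
    (beta : vertex -> R[i]) s :
  (forall w, A w -> size w = k.+1) ->
  (forall w1 w2, A w1 -> B (vtx w1 k) w2 ->
     size w2 = m.+1 /\ vtx w2 0 = vtx w1 k) ->
  (forall w, A w -> wt w != 0 -> sums_on (B (vtx w k)) wt (beta (vtx w k))) ->
  sums_on [set w | [/\ size w = (k + m).+1, A (take k.+1 w)
                     & B (vtx w k) (drop k w)]] wt s ->
  sums_on A (fun w => wt w * beta (vtx w k)) s.
Proof.
move=> sA sB Bbeta Xs.
apply: (@sums_on_fibers _ _ _ _ _ _ (take k.+1) _ _ _ Xs) => [w []//|].
move=> w1 Aw1; have sw1 := sA _ Aw1.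
have [wt0|wt_neq0] := eqVneq (wt w1) 0.
  rewrite wt0 mul0r; apply: sums_on0 => w /set_mem[[sw _ _] ww1].
  by rewrite (walk_weight_cut sw) ww1 wt0 mul0r.
(* The last vertex of [w1] is the first of [w2]; [behead] removes the duplicate. *)
pose join w2 := w1 ++ behead w2.
have joinK w2 : B (vtx w1 k) w2 -> drop k (join w2) = w2.
  move=> /(sB _ _ Aw1)[]; case: w2 => [//|b w2] _ w2b.
  rewrite /join /= drop_cat sw1 ltnS leqnn.
  rewrite (drop_nth vertex1) ?sw1 // drop_oversize ?sw1 //.
  by move: w2b; rewrite /vtx /= => ->.
have take_join w2 : take k.+1 (join w2) = w1 by rewrite take_size_cat.
rewrite (_ : [set _ | _] = join @` B (vtx w1 k)).
  apply: sums_on_image (sums_onZ (wt w1) (Bbeta _ Aw1 wt_neq0)).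
    move=> x y /set_mem Bx /set_mem By xy.
    by rewrite -(joinK x) // xy joinK.
  move=> w2 /set_mem Bw2; rewrite (@walk_weight_cut k m) ?take_join ?joinK //.
  by rewrite size_cat size_behead sw1 (sB _ _ Aw1 Bw2).1 addSn.
apply/seteqP; split=> [w [[sw _ Bw] ww1]|_ [w2 Bw2 <-]] /=.
  exists (drop k w); first by rewrite -ww1 vtx_take.
  by rewrite /join -drop1 drop_drop add1n -ww1 cat_take_drop.
rewrite take_join joinK //; split=> //; split=> //.
  by rewrite size_cat size_behead sw1 (sB _ _ Aw1 Bw2).1 addSn.
by rewrite -(vtx_take _ (leqnn k)) take_join.
Qed.

(** When all first pieces end at [b], the second piece ranges over a fixed set and the double sum
    factors. *)
Lemma sums_on_cut_at k m b (A B : set (seq vertex)) alpha beta s :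
  (forall w, A w -> size w = k.+1 /\ vtx w k = b) ->
  (forall w, B w -> size w = m.+1 /\ vtx w 0 = b) ->
  sums_on A wt alpha -> sums_on B wt beta ->
  sums_on [set w | [/\ size w = (k + m).+1, A (take k.+1 w) & B (drop k w)]]
    wt s ->
  alpha * beta = s.
Proof.
move=> sA sB Aa Bb Xs.
have ABs := @sums_on_cut k m A (fun=> B) (fun=> beta) s
  (fun w Aw => (sA w Aw).1) _ (fun _ _ _ => Bb) Xs.
rewrite mulrC; apply: sums_on_unique (sums_onZ beta Aa) _.
rewrite (_ : (fun w => _) = fun w => wt w * beta); last first.
  by apply/funext => w; rewrite mulrC.
apply: ABs => w1 w2 Aw1 Bw2.
by have [_ ->] := sA _ Aw1; exact: sB.
Qed.

Hypothesis h_light : light h.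

Lemma light_sums_on n (X : set (seq vertex)) : X `<=` walks_from1 n ->
  sums_on X wt (weight_of h X).
Proof. by move=> Xn; apply: abs_sumP Xn (h_light n). Qed.

(** The walks are partitioned by the first time [k >= lo] at which they are at [b], and each class
    is cut there into independent pieces of lengths [k] and [n - k]. *)
Lemma sums_on_first_passage lo b c n (f d : nat -> R[i]) :
  (forall k, sums_on (first_passage lo b k) wt (f k)) ->
  (forall k, sums_on (walks_between b k c) wt (d k)) ->
  sums_on [set w | [/\ walks_from1 n w, vtx w n = c
                     & exists i, (lo <= i <= n)%N /\ vtx w i = b]] wt
    (cauchy_prod f d n).
Proof.
move=> ff dd.
pose Y k := [set w | [/\ walks_from1 n w, vtx w n = c & [/\ (lo <= k)%N,
  vtx w k = b & forall i, (lo <= i < k)%N -> vtx w i != b]]].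
apply: (@sums_on_bigcup _ _ _ Y _ _ (fun k => f k * d (n - k)%N)).
- move=> k w kn [w1 wc [lok wk _]]; split=> //; exists k.
  by rewrite lok -ltnS.
- move=> w [w1 wc [i [/andP[loi lin] wi]]].
  pose P i := (lo <= i)%N && (vtx w i == b).
  have exP : exists i, P i by exists i; rewrite /P loi wi eqxx.
  case: (ex_minnP exP) => k /andP[lok /eqP wk] kmin; exists k.
    by rewrite ltnS (leq_trans _ lin) // kmin // /P loi wi eqxx.
  split=> //; split=> // j /andP[loj jk]; apply/negP => wj.
  by move: jk; rewrite ltnNge kmin // /P loj wj.
- move=> w j k _ _ [_ _ [loj wj jmin]] [_ _ [lok wk kmin]].
  (* Of two distinct first times, the earlier contradicts the minimality of the later. *)
  by case: (ltngtP j k) => // [jk|kj];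
    [have := kmin j | have := jmin k]; rewrite ?loj ?lok ?jk ?kj ?wj ?wk ?eqxx;
    move=> /(_ isT).
move=> k; rewrite ltnS => kn.
have Ysum : sums_on (Y k) wt (weight_of h (Y k)).
  by apply: (@light_sums_on n) => w [].
have YE : Y k = [set w | [/\ size w = (k + (n - k)).+1,
    first_passage lo b k (take k.+1 w)
    & walks_between b (n - k) c (drop k w)]].
  apply/seteqP; split=> w; rewrite /Y /= /first_passage /walks_between /=.
    move=> [[wn w1] wc [lok wk wlo]].
    move: (wn); rewrite -{1}(subnKC kn) => /walk_cut[sw wwk wwm].
    split=> //; split; rewrite ?vtx_take ?vtx_drop ?addn0 ?subnKC //.
      by split; rewrite ?vtx_take.
    by move=> i /andP[loi ik]; rewrite vtx_take ?(ltnW ik) // wlo // loi.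
  move=> [sw [lok [wwk w1] wk wlo] [wwm _ wc]].
  have : walk (k + (n - k)) w by apply/walk_cut.
  rewrite subnKC // => wn; move: w1 wk wc.
  rewrite !vtx_take ?vtx_drop // subnKC // => w1 wk wc; split=> //.
  split=> // i /andP[loi ik].
  by have := wlo i; rewrite loi ik vtx_take ?(ltnW ik) //; apply.
rewrite (_ : f k * _ = weight_of h (Y k)) //.
have {}Ysum : sums_on [set w | [/\ size w = (k + (n - k)).+1,
    first_passage lo b k (take k.+1 w)
    & walks_between b (n - k) c (drop k w)]] wt (weight_of h (Y k)).
  by rewrite -YE.
apply: (@sums_on_cut_at k (n - k) b _ _ _ _ _ _ _ (ff k) (dd (n - k)%N) Ysum).
  by move=> w [_ [[sw _] _] wb _].
by move=> w [[sw _] w0 _].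
Qed.

End Walks.

(** * Renewal identities for the walk series *)

Section Renewal.
Variables (R : realType) (h : edge -> R[i]) (v : vertex).
Hypotheses (v_neq1 : v != vertex1) (h_light : light h).
Implicit Types (a b c u : vertex) (w : seq vertex).
Local Notation wt := (walk_weight h).

Lemma vtx_map (f : vertex -> vertex) w i : (i < size w)%N ->
  vtx (map f w) i = f (vtx w i).
Proof. by move=> iw; rewrite /vtx (nth_map vertex1). Qed.

Lemma walk_map (f : vertex -> vertex) n w : injective f -> walk n w ->
  walk n (map f w).
Proof.
move=> f_inj [sw ww]; split=> [|i ni]; first by rewrite size_map.
by rewrite !vtx_map ?sw ?ltnS // ?(ltnW ni) // (inj_eq f_inj) ww.
Qed.

Lemma vtx_rev n w i : size w = n.+1 -> (i <= n)%N ->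
  vtx (rev w) i = vtx w (n - i).
Proof. by move=> sw ni; rewrite /vtx nth_rev ?sw. Qed.

Lemma walk_rev n w : walk n w -> walk n (rev w).
Proof.
move=> [sw ww]; split=> [|i ni]; first by rewrite size_rev.
rewrite !(vtx_rev sw) // ?(ltnW ni) // eq_sym -(subnSK ni) ww //.
by rewrite subnSK // leq_subr.
Qed.

Lemma walk_weight_rev n w : size w = n.+1 -> wt (rev w) = wt w.
Proof.
move=> sw; rewrite /walk_weight size_rev sw /= (reindex_inj rev_ord_inj) /=.
apply: eq_bigr => i _; have ni := ltn_ord i.
by rewrite subnSK // ewC !(vtx_rev sw) ?leq_subr // !subKn // ltnW.
Qed.

Lemma sums_on_loops n :
  sums_on (walks_between vertex1 n vertex1) wt (B_series h n).
Proof.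
have := @light_sums_on _ _ h_light n
  [set w | walks_from1 n w /\ vtx w n = vertex1] (fun w => @proj1 _ _).
by congr (sums_on _ _ _); apply/seteqP; split=> w [] // [].
Qed.

(** The bijection [f] carries loops at 1 onto loops at [v] and preserves weights. *)
Lemma sums_on_loops_transitive n : transitive_weight h v ->
  sums_on (walks_between v n v) wt (B_series h n).
Proof.
move=> [f [[g fK gK] f1 hf]].
have f_inj := can_inj fK; have g_inj := can_inj gK.
rewrite (_ : walks_between v n v =
  map f @` walks_between vertex1 n vertex1); last first.
  apply/seteqP; split=> [w [wn w0 wv]|_ [w [wn w0 wv] <-]].
    have [sw _] := wn; exists (map g w); last first.
      by rewrite -map_comp map_id_in // => x _; exact: gK.
    by split; [exact: walk_map | |]; rewrite vtx_map ?sw // ?w0 ?wv -f1 fK.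
  have [sw _] := wn.
  by split; [exact: walk_map | |]; rewrite vtx_map ?sw // ?w0 ?wv f1.
apply: sums_on_image (sums_on_loops n).
  by move=> x y _ _; exact: (inj_map f_inj).
move=> w /set_mem [[sw ww] _ _]; rewrite /walk_weight size_map sw /=.
apply: eq_bigr => i _; have ni := ltn_ord i.
by rewrite !vtx_map ?sw // ?ltnS ?(ltnW ni) // hf // ww.
Qed.

Lemma sums_on_first_passage_Cv n :
  sums_on (first_passage 0 v n) wt (Cv_series h v n).
Proof.
rewrite (_ : first_passage 0 v n = [set w | [/\ walks_from1 n w, vtx w n = v
    & forall i, (i < n)%N -> vtx w i != v]]).
  by apply: (@light_sums_on _ _ h_light n) => w [].
by apply/seteqP; split=> w; [case|case=> ? ? ?; split].
Qed.

Lemma sums_on_first_passage_C n :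
  sums_on (first_passage 1 vertex1 n) wt (C_series h n).
Proof. by apply: (@light_sums_on _ _ h_light n) => w []. Qed.

(** A loop of positive length returns to 1 at its end at the latest, so it has a first return; the
    trivial loop contributes the unit series. *)
Lemma B_series_return :
  B_series h = unit_series R[i] + cauchy_prod (C_series h) (B_series h).
Proof.
apply/funext => n; rewrite -[RHS]/(unit_series _ n + cauchy_prod _ _ n).
have := @sums_on_first_passage _ _ h_light 1 vertex1 vertex1 n _ _
  sums_on_first_passage_C
  sums_on_loops.
case: n => [|n] Nsum.
  (* At length 0 no time [i] satisfies [1 <= i <= 0]. *)
  rewrite (_ : cauchy_prod _ _ _ = 0) ?addr0; last first.
    apply: sums_on_unique Nsum _; apply: sums_on0 => w /set_mem[_ _ [i []]].
    by case: i.
  apply: sums_on_unique (sums_on_loops _) _.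
  rewrite (_ : walks_between _ _ _ = [set [:: vertex1]]).
    have := sums_on_set1 [:: vertex1] wt.
    by rewrite {2}/walk_weight big_ord0.
  apply/seteqP; split=> [w [[sw _] w0 _]|_ ->]; last by split.
  by case: w sw w0 => [|x []] //= _ <-.
rewrite /unit_series add0r; apply: sums_on_unique (sums_on_loops _) _.
move: Nsum; congr (sums_on _ _ _); apply/seteqP; split=> w.
  by case=> [[wn w1] wc _]; split.
move=> [wn w1 wc]; split=> //; exists n.+1; split=> //.
by rewrite leqnn.
Qed.

(** The endpoint is itself a visit to [v], so a first visit always exists; what follows it is a loop
    at [v]. *)
Lemma sums_on_walks_to_v n : transitive_weight h v ->
  sums_on (walks_between vertex1 n v) wt
    (cauchy_prod (Cv_series h v) (B_series h) n).
Proof.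
move=> h_tr; have := @sums_on_first_passage _ _ h_light 0 v v n _ _
  sums_on_first_passage_Cv (fun k => @sums_on_loops_transitive k h_tr).
congr (sums_on _ _ _); apply/seteqP; split=> w; first by case=> [[]].
by case=> wn w1 wv; split=> //; exists n; rewrite leqnn.
Qed.

(** Edges are unordered, so reversal preserves weights and exchanges the two endpoints. *)
Lemma sums_on_walks_from_v n : transitive_weight h v ->
  sums_on (walks_between v n vertex1) wt
    (cauchy_prod (Cv_series h v) (B_series h) n).
Proof.
move=> h_tr; rewrite (_ : walks_between v n vertex1 =
    rev @` walks_between vertex1 n v); last first.
  have rev_between a b w : walks_between a n b w -> walks_between b n a (rev w).
    move=> [wn wa wb]; have [sw _] := wn; split; first exact: walk_rev.
      by rewrite /vtx nth_rev ?sw // subn1.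
    by rewrite /vtx nth_rev ?sw // subnn.
  apply/seteqP; split=> [w /rev_between wr|_ [w /rev_between wr <-]//].
  by exists (rev w); rewrite ?revK.
apply: sums_on_image (sums_on_walks_to_v n h_tr).
  by move=> x y _ _ /(congr1 rev); rewrite !revK.
by move=> w /set_mem[[sw _] _ _]; exact: walk_weight_rev sw.
Qed.

(** A loop at 1 either avoids [v] or is cut at its first visit to [v]. *)
Lemma B_series_avoid : transitive_weight h v ->
  B_series h = Bv_series h v +
    cauchy_prod (Cv_series h v) (cauchy_prod (Cv_series h v) (B_series h)).
Proof.
move=> h_tr; apply/funext => n.
rewrite -[RHS]/(Bv_series h v n + cauchy_prod _ _ n).
apply: abs_sumE; apply: sums_onU _ _ _
  (@sums_on_first_passage _ _ h_light 0 v vertex1 n _ _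
  sums_on_first_passage_Cv (fun k => @sums_on_walks_from_v k h_tr)); last first.
- by apply: (@light_sums_on _ _ h_light n) => w [].
- by move=> w [_ _ wv] [_ _ [i [/andP[_ /wv/eqP]]]].
move=> w; split=> [[w1 wn]|[[]|[]]] //.
have [wv|wv] := pselect (exists i, (0 <= i <= n)%N /\ vtx w i = v).
  by right.
left.
by split=> // i ni; apply/eqP => wi; apply: wv; exists i.
Qed.

(** Induction on the length: the step adds exactly the walks that first reach [v] at the new
    endpoint. *)
Lemma visit_weight_partial_sums : convex_weight h ->
  visit_weight h v = partial_sums (Cv_series h v).
Proof.
move=> h_cvx; apply/funext; elim=> [|n IHn].
  (* At length 0 the only walk stays at 1, which differs from [v], so neither set has an element. *)
  rewrite /partial_sums big_ord_recl big_ord0 addr0; congr (abs_sum _ _).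
  apply/seteqP; split=> w.
    case=> [[[sw ww] w1] wv]; split=> //.
    by case: w sw wv w1 {ww} => [|x []] //= _; rewrite inE => /eqP->.
  case=> [[[sw ww] w1] wv _]; move: v_neq1; rewrite -wv.
  by move: w1; rewrite /vtx => ->; rewrite eqxx.
rewrite /partial_sums big_ord_recr /= -[X in X + _]/(partial_sums _ n) -IHn.
apply: abs_sumE.
pose A := [set w | walks_from1 n w /\ v \in w].
(* By convexity, appending one more step to the walks of A does not change their
   total weight. *)
pose X := [set w | walks_from1 n.+1 w /\ A (take n.+1 w)].
have Xsum : sums_on X wt (visit_weight h v n).
  have Xs : sums_on X wt (weight_of h X).
    by apply: (@light_sums_on _ _ h_light n.+1) => w [].
  rewrite (_ : visit_weight h v n = weight_of h X) //.
  have As : sums_on A wt (visit_weight h v n).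
    by apply: (@light_sums_on _ _ h_light n) => w [].
  apply: sums_on_unique As _.
  suff : sums_on A (fun w => wt w * 1) (weight_of h X).
    by apply: eq_sums_on => w _; rewrite mulr1.
  apply: (@sums_on_cut _ h n 1 A (fun b => [set w | walk 1 w /\ vtx w 0 = b])
    (fun=> 1)).
  - by move=> w [[[]]].
  - by move=> w1 w2 _ [[sw2 _] ->].
  - move=> w [[wn w1] _] wt0.
    (* The walk [w] has nonzero weight, so its endpoint [b] is reachable and convexity applies
       there. *)
    set b := vtx w n; have [bsum b1] : abs_summable [set u | u <> b] (ew h b) /\
        abs_sum [set u | u <> b] (ew h b) = 1.
      by apply: h_cvx; exists n, w.
    have := abs_sumP (fun _ x => x) bsum; rewrite b1 => hb.
    (* One-step walks from [b] correspond to the vertices other than [b]. *)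
    rewrite (_ : [set _ | _] = (fun u => [:: b; u]) @` [set u | u <> b]).
      apply: sums_on_image hb; first by move=> x y _ _ [].
      by move=> u _; rewrite /walk_weight big_ord_recl big_ord0 mulr1.
    apply/seteqP; split=> [w' [[sw ww] w0]|_ [u ub <-]].
      case: w' sw ww w0 => [|x [|y []]] //= _ ww w0.
      exists y; last by rewrite -w0.
      by rewrite -w0 => xy; have := ww 0%N isT; rewrite xy eqxx.
    by split=> //; split=> // -[|//] _; apply/eqP => /esym.
  move: Xs; congr (sums_on _ _ _); apply/seteqP; split=> w.
    case=> [[wn w1] Aw]; move: (wn); rewrite -{1}addn1 => /walk_cut[sw _ wm].
    by split=> //; split=> //; rewrite vtx_drop addn0.
  case=> sw Aw [wm _]; split=> //; have [[wk w1] _] := Aw.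
  by split; [rewrite -addn1; apply/walk_cut | rewrite -w1 vtx_take].
have mem_take_vtx w i : size w = n.+2 -> (i <= n)%N -> vtx w i \in take n.+1 w.
  by move=> sw ni; rewrite -(vtx_take _ ni) /vtx mem_nth // size_takel ?sw.
(* A walk of length [n.+1] visiting [v] does so among its first [n.+1] vertices, or else only at its
   last one. *)
apply: sums_onU Xsum (@light_sums_on _ _ h_light n.+1 _ _) => [w|w|w []//].
  split=> [[w1 wv]|[[w1 [_ wv]]|[w1 wv _]]].
  - have [[sw ww] w0] := w1.
    have [wv'|wv'] := boolP (v \in take n.+1 w); [left|right].
      split=> //; split=> //; split; last by rewrite vtx_take.
      by have /walk_cut[] : walk (n + 1) w by rewrite addn1.
    split=> // [|i ni].
    2: by apply: contraNneq wv' => <-; exact: mem_take_vtx.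
    have /(nthP vertex1)[i iw wi] := wv; move: iw; rewrite sw ltnS leq_eqVlt.
    case/predU1P => [<-//|ni]; case/negP: wv'.
    by rewrite -wi; exact: mem_take_vtx.
  - by split=> //; exact: mem_take wv.
  split=> //; have [[sw _] _] := w1.
  by rewrite -wv /vtx mem_nth ?sw.
move=> [[[sw _] _] [_ vw]]; have /(nthP vertex1)[i iw wi] := vw.
move: iw; rewrite size_takel ?sw // => ni [_ _ /(_ i ni)/eqP]; apply.
by rewrite -wi -(@vtx_take n).
Qed.

End Renewal.

(** * The limit of the visit weights *)

Theorem theorem10 (R : realType) (v : vertex) (h : edge -> R[i])
    (v_neq1 : v != vertex1)
    (h_transitive : transitive_weight h v)
    (h_light : light h)
    (h_convex : convex_weight h)
    (v_reachable : reachable h v)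
    (Cv_exists : has_value1 (Cv_series h v))
    (C_exists : has_value1 (C_series h))
    (Bv_exists : has_value1 (Bv_series h v))
    (B_exists : has_value1 (B_series h)) :
  value1 (B_series h) != 0 /\
  exists l : R[i]^o,
    visit_weight h v n @[n --> \oo] --> l /\
    l \in csqrt (1 - value1 (Bv_series h v) / value1 (B_series h)).
Proof.
have value1P (u : nat -> R[i]) :
  has_value1 u -> tends (partial_sums u) (value1 u).
  by move=> ue; apply/tendsP.
have [B_neq0 CvE] := value_renewal (value1P _ B_exists) (value1P _ C_exists)
  (value1P _ Bv_exists) (value1P _ Cv_exists) (B_series_return h_light)
  (B_series_avoid h_light h_transitive).
split=> //; exists (value1 (Cv_series h v)); split; last exact/mem_set.
(* The visit weights are the partial sums of [Cv_series], so their limit is its value at 1. *)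
rewrite (visit_weight_partial_sums v_neq1 h_light h_convex).
exact: (tendsP _ _).1 (value1P _ Cv_exists).
Qed.
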